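(* Let $\mathbb{K}$ be an arbitrary field and let $G=\langle e_1,e_2\rangle\cong\mathbb{Z}^2$. Then the ideal $\mathrm{Id}_G(\mathrm{UT}_3^{(-)}(\mathbb{K}),\Gamma(e_1,e_2))$ is generated, as a $T_G$-ideal, by: (i) $x_g$, for $g\notin\mathrm{Supp}\,\Gamma(e_1,e_2)$; (ii) $[y_1,y_2]$. In addition, if $\mathbb{K}$ is a finite field containing $q$ elements, then we include (iii) $[x_g,y^{(q)}]-[x_g,y]$, for $g\in\{e_1,e_2,e_1e_2\}$. A basis of the relatively free algebra $\mathcal{L}(X^G)$, modulo $\mathrm{Id}_G(\mathrm{UT}_3^{(-)},\Gamma(e_1,e_2))$, consists of all the following polynomials: $$[x_g,y_1^{(p_1)},\ldots,y_r^{(p_r)}],$$ $$[x_{e_1},y_1^{(p_1)},\ldots,y_r^{(p_r)},x_{e_2},y_1^{(q_1)},\ldots,y_r^{(q_r)}],$$ where $g\in\{e_1,e_2,e_1e_2\}$, $r\ge 0$, and $0\le p_\ell,q_\ell<|\mathbb{K}|$ for each $\ell\in\{1,2,\ldots,r\}$.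
   Context: $\mathrm{UT}_3^{(-)}=\mathrm{UT}_3^{(-)}(\mathbb{K})$ is the Lie algebra of upper triangular $3\times3$ matrices over $\mathbb{K}$ with bracket $[a,b]=ab-ba$; $e_{ij}$ are the matrix units. The group $G$ is the free abelian group, written multiplicatively with neutral element $1$, with free generators $e_1,e_2$. $\Gamma(e_1,e_2)$ is the $G$-grading on $\mathrm{UT}_3^{(-)}$ with $\deg e_{ii}=1$, $\deg e_{12}=e_1$, $\deg e_{23}=e_2$, $\deg e_{13}=e_1e_2$; its support is $\mathrm{Supp}\,\Gamma(e_1,e_2)=\{1,e_1,e_2,e_1e_2\}$. $\mathcal{L}(X^G)$ is the free $G$-graded Lie algebra over $\mathbb{K}$ freely generated by $X^G=\{x_{i,g}\mid i\in\mathbb{N},g\in G\}$ with $\deg x_{i,g}=g$. A symbol $x_g$ denotes a variable of degree $g$; $y,y_1,y_2,\ldots$ denote variables of trivial degree $1$. Commutators are left-normed, and $[x,y^{(m)}]=[x,y,\ldots,y]$ with $y$ repeated $m$ times. $\mathrm{Id}_G(\mathrm{UT}_3^{(-)},\Gamma(e_1,e_2))$ is the set of all $f\in\mathcal{L}(X^G)$ that vanish under every graded homomorphism from $\mathcal{L}(X^G)$ to $\mathrm{UT}_3^{(-)}$ endowed with $\Gamma(e_1,e_2)$. A $T_G$-ideal is an ideal of $\mathcal{L}(X^G)$ invariant under all graded endomorphisms. If $\mathbb{K}$ is infinite, the condition $p_\ell,q_\ell<|\mathbb{K}|$ imposes no upper bound.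
   Formalization: The variables y of trivial degree are added to the two listed families in the basis: as printed, the families do not span, since y_1 is not a graded identity and every listed polynomial has degree e_1, e_2 or e_1e_2. *)

(* Defs.v *)
From HB Require Import structures.
From mathcomp Require Import all_boot all_order all_algebra.
From mathcomp Require Import all_classical.
From mathcomp Require Import ring.

Set Implicit Arguments.
Unset Strict Implicit.
Unset Printing Implicit Defensive.

Import GRing.Theory.
Local Open Scope ring_scope.
Local Open Scope quotient_scope.
Local Open Scope classical_set_scope.
Local Open Scope card_scope.

(* Lie algebras: the alternating law [x, x] = 0 is required as such, since     *)
(* antisymmetry is too weak in characteristic 2.                              *)
HB.mixin Record Lmodule_isLie (K : fieldType) L of GRing.Lmodule K L := {
  brk : L -> L -> L;
  brkDl : forall x y z, brk (x + y) z = brk x z + brk y z;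
  brkDr : forall x y z, brk x (y + z) = brk x y + brk x z;
  brkZl : forall a x y, brk (a *: x) y = a *: brk x y;
  brkZr : forall a x y, brk x (a *: y) = a *: brk x y;
  brkxx : forall x, brk x x = 0;
  brk_jacobi : forall x y z,
    brk (brk x y) z + brk (brk y z) x + brk (brk z x) y = 0
}.

#[short(type="lieAlgType")]
HB.structure Definition LieAlgebra (K : fieldType) :=
  {L of GRing.Lmodule K L & Lmodule_isLie K L}.

Definition lie_hom (K : fieldType) (L M : lieAlgType K)
  (f : {linear L -> M}) : Prop := {morph f : x y / brk x y}.

Definition lie_ideal (K : fieldType) (L : lieAlgType K) (I : set L) : Prop :=
  [/\ I 0,
      forall x y, I x -> I y -> I (x + y),
      forall (a : K) x, I x -> I (a *: x)
    & forall x y, I x -> I (brk x y)].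

(* Left-normed commutator [x, s_1, ..., s_n]. *)
Definition lnorm (K : fieldType) (L : lieAlgType K) (x : L) (s : seq L) : L :=
  foldl (@brk K L) x s.

(* The free Lie algebra on X: nonassociative polynomial expressions in X,     *)
(* modulo the least congruence imposing the axioms of Lie algebras.           *)
Inductive lterm (K X : Type) : Type :=
| LVar of X
| LZero
| LAdd of lterm K X & lterm K X
| LScale of K & lterm K X
| LBrk of lterm K X & lterm K X.
Arguments LVar {K X}.
Arguments LZero {K X}.

HB.instance Definition _ (K X : Type) := gen_eqMixin (lterm K X).
HB.instance Definition _ (K X : Type) := gen_choiceMixin (lterm K X).

Inductive lcongr (K : fieldType) (X : Type) : lterm K X -> lterm K X -> Prop :=
| lc_refl t : lcongr t t
| lc_sym t u : lcongr t u -> lcongr u t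
| lc_trans t u v : lcongr t u -> lcongr u v -> lcongr t v
| lc_add t t' u u' : lcongr t t' -> lcongr u u' ->
    lcongr (LAdd t u) (LAdd t' u')
| lc_scale a t t' : lcongr t t' -> lcongr (LScale a t) (LScale a t')
| lc_brk t t' u u' : lcongr t t' -> lcongr u u' ->
    lcongr (LBrk t u) (LBrk t' u')
| lc_addA t u v : lcongr (LAdd t (LAdd u v)) (LAdd (LAdd t u) v)
| lc_addC t u : lcongr (LAdd t u) (LAdd u t)
| lc_add0 t : lcongr (LAdd LZero t) t
| lc_addN t : lcongr (LAdd (LScale (-1) t) t) LZero
| lc_scaleA a b t : lcongr (LScale a (LScale b t)) (LScale (a * b) t)
| lc_scale1 t : lcongr (LScale 1 t) t
| lc_scaleDr a t u : lcongr (LScale a (LAdd t u)) (LAdd (LScale a t) (LScale a u))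
| lc_scaleDl a b t : lcongr (LScale (a + b) t) (LAdd (LScale a t) (LScale b t))
| lc_brkDl t u v : lcongr (LBrk (LAdd t u) v) (LAdd (LBrk t v) (LBrk u v))
| lc_brkDr t u v : lcongr (LBrk t (LAdd u v)) (LAdd (LBrk t u) (LBrk t v))
| lc_brkZl a t u : lcongr (LBrk (LScale a t) u) (LScale a (LBrk t u))
| lc_brkZr a t u : lcongr (LBrk t (LScale a u)) (LScale a (LBrk t u))
| lc_brkxx t : lcongr (LBrk t t) LZero
| lc_jacobi t u v : lcongr
    (LAdd (LAdd (LBrk (LBrk t u) v) (LBrk (LBrk u v) t)) (LBrk (LBrk v t) u))
    LZero.

Definition lcongrb (K : fieldType) (X : Type) : rel (lterm K X) :=
  fun t u => `[< lcongr t u >].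

Lemma lcongrb_refl (K : fieldType) (X : Type) : reflexive (@lcongrb K X).
Proof. by move=> t; apply/asboolP/lc_refl. Qed.

Lemma lcongrb_sym (K : fieldType) (X : Type) : symmetric (@lcongrb K X).
Proof. by move=> t u; apply: asbool_equiv_eq; split; apply: lc_sym. Qed.

Lemma lcongrb_trans (K : fieldType) (X : Type) : transitive (@lcongrb K X).
Proof.
by move=> u t v /asboolP tu /asboolP uv; apply/asboolP/(lc_trans tu).
Qed.

Canonical lcongr_equiv (K : fieldType) (X : Type) :=
  EquivRel (@lcongrb K X) (@lcongrb_refl K X) (@lcongrb_sym K X)
    (@lcongrb_trans K X).

Definition freeLie (K : fieldType) (X : Type) := {eq_quot (@lcongrb K X)}.

HB.instance Definition _ (K : fieldType) (X : Type) :=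
  Choice.on (freeLie K X).
HB.instance Definition _ (K : fieldType) (X : Type) :=
  EqQuotient.on (freeLie K X).

Section FreeLie.
Variables (K : fieldType) (X : Type).
Local Notation F := (freeLie K X).
Local Notation T := (lterm K X).

Definition fl_class (t : T) : F := \pi_F t.

Lemma fl_classP t u : fl_class t = fl_class u <-> lcongr t u.
Proof.
split=> [/eqmodP/asboolP //|tu]; exact/eqmodP/asboolP.
Qed.

Lemma fl_reprK (x : F) : fl_class (repr x) = x. Proof. exact: reprK. Qed.

Lemma fl_repr t : lcongr (repr (fl_class t)) t.
Proof. by apply/fl_classP; rewrite fl_reprK. Qed.

Lemma fl_ind (P : F -> Prop) : (forall t, P (fl_class t)) -> forall x, P x.
Proof. by move=> h x; rewrite -[x]fl_reprK. Qed.

Definition fl_var (i : X) : F := fl_class (LVar i).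
Definition fl_zero : F := fl_class LZero.
Definition fl_add (x y : F) : F := fl_class (LAdd (repr x) (repr y)).
Definition fl_scale (a : K) (x : F) : F := fl_class (LScale a (repr x)).
Definition fl_opp (x : F) : F := fl_scale (-1) x.
Definition fl_brk (x y : F) : F := fl_class (LBrk (repr x) (repr y)).

Lemma fl_addE t u : fl_add (fl_class t) (fl_class u) = fl_class (LAdd t u).
Proof. by apply/fl_classP/lc_add; apply: fl_repr. Qed.
Lemma fl_scaleE a t : fl_scale a (fl_class t) = fl_class (LScale a t).
Proof. by apply/fl_classP/lc_scale; apply: fl_repr. Qed.
Lemma fl_brkE t u : fl_brk (fl_class t) (fl_class u) = fl_class (LBrk t u).
Proof. by apply/fl_classP/lc_brk; apply: fl_repr. Qed.

Let flE := (fl_addE, fl_scaleE, fl_brkE).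
Local Ltac flsolve ax :=
  repeat (elim/fl_ind => ?); rewrite ?flE; apply/fl_classP; apply ax.

Lemma fl_addA : associative fl_add. Proof. flsolve lc_addA. Qed.
Lemma fl_addC : commutative fl_add. Proof. flsolve lc_addC. Qed.
Lemma fl_add0 : left_id fl_zero fl_add. Proof. flsolve lc_add0. Qed.
Lemma fl_addN : left_inverse fl_zero fl_opp fl_add.
Proof. rewrite /fl_opp; flsolve lc_addN. Qed.

HB.instance Definition _ :=
  GRing.isZmodule.Build F fl_addA fl_addC fl_add0 fl_addN.

Lemma fl_scaleA a b (x : F) : fl_scale a (fl_scale b x) = fl_scale (a * b) x.
Proof. move: x; flsolve lc_scaleA. Qed.
Lemma fl_scale1 : left_id 1 fl_scale. Proof. flsolve lc_scale1. Qed.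
Lemma fl_scaleDr : right_distributive fl_scale fl_add.
Proof. move=> a; flsolve lc_scaleDr. Qed.
Lemma fl_scaleDl a b (x : F) :
  fl_scale (a + b) x = fl_add (fl_scale a x) (fl_scale b x).
Proof. move: x; flsolve lc_scaleDl. Qed.

HB.instance Definition _ :=
  GRing.Zmodule_isLmodule.Build K F fl_scaleA fl_scale1 fl_scaleDr
    (fun x a b => fl_scaleDl a b x).

Lemma fl_brkDl x y z :
  fl_brk (fl_add x y) z = fl_add (fl_brk x z) (fl_brk y z).
Proof. move: x y z; flsolve lc_brkDl. Qed.
Lemma fl_brkDr x y z :
  fl_brk x (fl_add y z) = fl_add (fl_brk x y) (fl_brk x z).
Proof. move: x y z; flsolve lc_brkDr. Qed.
Lemma fl_brkZl a x y : fl_brk (fl_scale a x) y = fl_scale a (fl_brk x y).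
Proof. move: x y; flsolve lc_brkZl. Qed.
Lemma fl_brkZr a x y : fl_brk x (fl_scale a y) = fl_scale a (fl_brk x y).
Proof. move: x y; flsolve lc_brkZr. Qed.
Lemma fl_brkxx x : fl_brk x x = fl_zero.
Proof. move: x; flsolve lc_brkxx. Qed.
Lemma fl_jacobi x y z :
  fl_add (fl_add (fl_brk (fl_brk x y) z) (fl_brk (fl_brk y z) x))
    (fl_brk (fl_brk z x) y) = fl_zero.
Proof. move: x y z; flsolve lc_jacobi. Qed.

HB.instance Definition _ := Lmodule_isLie.Build K F
  fl_brkDl fl_brkDr fl_brkZl fl_brkZr fl_brkxx fl_jacobi.

Section Lift.
Variables (M : lieAlgType K) (f : X -> M).

Fixpoint lterm_eval (t : T) : M :=
  match t with
  | LVar i => f i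
  | LZero => 0
  | LAdd t u => lterm_eval t + lterm_eval u
  | LScale a t => a *: lterm_eval t
  | LBrk t u => brk (lterm_eval t) (lterm_eval u)
  end.

Lemma lterm_eval_congr t u : lcongr t u -> lterm_eval t = lterm_eval u.
Proof.
elim=> //=.
- by move=> ? ? ? _ -> _ ->.
- by move=> ? ? ? ? _ -> _ ->.
- by move=> ? ? ? _ ->.
- by move=> ? ? ? ? _ -> _ ->.
- by move=> *; rewrite addrA.
- by move=> *; rewrite addrC.
- by move=> *; rewrite add0r.
- by move=> *; rewrite scaleN1r addNr.
- by move=> *; rewrite scalerA.
- by move=> *; rewrite scale1r.
- by move=> *; rewrite scalerDr.
- by move=> *; rewrite scalerDl.
- by move=> *; rewrite brkDl.
- by move=> *; rewrite brkDr.
- by move=> *; rewrite brkZl.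
- by move=> *; rewrite brkZr.
- by move=> *; rewrite brkxx.
- by move=> *; rewrite brk_jacobi.
Qed.

Definition fl_lift (x : F) : M := lterm_eval (repr x).

Lemma fl_liftE t : fl_lift (fl_class t) = lterm_eval t.
Proof. exact/lterm_eval_congr/fl_repr. Qed.

Lemma fl_lift_linear : linear fl_lift.
Proof.
move=> a; elim/fl_ind => t; elim/fl_ind => u.
rewrite -[a *: fl_class t]/(fl_scale _ _) -[_ + _]/(fl_add _ _).
by rewrite fl_scaleE fl_addE !fl_liftE.
Qed.

HB.instance Definition _ :=
  GRing.isLinear.Build K F M *:%R fl_lift fl_lift_linear.

Lemma fl_lift_hom : lie_hom fl_lift.
Proof.
elim/fl_ind => t; elim/fl_ind => u /=.
by rewrite -[brk (fl_class t) _]/(fl_brk _ _) fl_brkE !fl_liftE.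
Qed.

Lemma fl_lift_var i : fl_lift (fl_var i) = f i.
Proof. exact: fl_liftE. Qed.

Lemma fl_lift_unique (h : {linear F -> M}) :
  lie_hom h -> (forall i, h (fl_var i) = f i) -> h =1 fl_lift.
Proof.
move=> hB hX; elim/fl_ind; elim=> [i||t IHt u IHu|a t IHt|t IHt u IHu].
- by rewrite fl_lift_var -hX.
- by rewrite fl_liftE /= -[fl_class LZero]/(0 : F) linear0.
- by rewrite -fl_addE -[fl_add _ _]/(_ + _ : F) !linearD IHt IHu.
- by rewrite -fl_scaleE -[fl_scale _ _]/(_ *: _ : F) !linearZ /= IHt.
- by rewrite -fl_brkE -[fl_brk _ _]/(brk _ _ : F) hB fl_lift_hom IHt IHu.
Qed.
End Lift.
End FreeLie.

(* The free abelian group on e_1, e_2 is written additively: its neutral      *)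
(* element 1 is 0 and the product e_1 e_2 is eone + etwo.                     *)
Definition G : zmodType := (int * int)%type.
Definition eone : G := (1, 0).
Definition etwo : G := (0, 1).

(* A family of homogeneous components is a map g |-> L_g. *)
Definition graded_hom (K : fieldType) (L M : lieAlgType K)
    (gL : G -> set L) (gM : G -> set M) (f : {linear L -> M}) : Prop :=
  lie_hom f /\ forall g x, gL g x -> gM g (f x).

(* L(X^G): the pair (i, g) indexes the variable x_{i,g}. *)
Definition LXG (K : fieldType) : lieAlgType K := freeLie K (nat * G).

Definition xvar (K : fieldType) (i : nat) (g : G) : LXG K := fl_var K (i, g).
Definition yvar (K : fieldType) (i : nat) : LXG K := xvar K i 0.

(* Component of degree g: the span of the Lie monomials of total degree g. *)
Inductive LXG_comp (K : fieldType) : G -> set (LXG K) :=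
| LXG_var i g : LXG_comp g (xvar K i g)
| LXG_zero g : LXG_comp g 0
| LXG_add g x y : LXG_comp g x -> LXG_comp g y -> LXG_comp g (x + y)
| LXG_scale g a x : LXG_comp g x -> LXG_comp g (a *: x)
| LXG_brk g h x y :
    LXG_comp g x -> LXG_comp h y -> LXG_comp (g + h) (brk x y).

Definition TG_ideal (K : fieldType) (I : set (LXG K)) : Prop :=
  lie_ideal I /\
  forall f : {linear LXG K -> LXG K},
    graded_hom (@LXG_comp K) (@LXG_comp K) f -> forall x, I x -> I (f x).

Definition TG_generated (K : fieldType) (S : set (LXG K)) : set (LXG K) :=
  smallest (@TG_ideal K) S.

Definition upper_tri (K : fieldType) : {pred 'M[K]_3} :=
  fun A => is_trig_mx A^T.

Lemma upper_triP (K : fieldType) (A : 'M[K]_3) :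
  reflect (forall i j : 'I_3, (j < i)%N -> A i j = 0) (A \in @upper_tri K).
Proof.
apply: (iffP is_trig_mxP) => h i j ij; first by rewrite -(h j i ij) mxE.
by rewrite mxE h.
Qed.

Lemma upper_tri_submod (K : fieldType) : submod_closed (@upper_tri K).
Proof.
split; first by apply/upper_triP => i j _; rewrite mxE.
move=> a A B /upper_triP hA /upper_triP hB; apply/upper_triP => i j ij.
by rewrite !mxE hA // hB // mulr0 addr0.
Qed.
HB.instance Definition _ (K : fieldType) :=
  GRing.isSubmodClosed.Build K 'M[K]_3 (@upper_tri K) (@upper_tri_submod K).

Record UT3 (K : fieldType) : Type :=
  MkUT3 { ut3_mx :> 'M[K]_3; ut3_mxP : ut3_mx \in @upper_tri K }.

HB.instance Definition _ (K : fieldType) := [isSub for @ut3_mx K].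
HB.instance Definition _ (K : fieldType) := [Choice of UT3 K by <:].
HB.instance Definition _ (K : fieldType) :=
  [SubChoice_isSubLmodule of UT3 K by <:].

Lemma upper_tri_mul (K : fieldType) (A B : 'M[K]_3) :
  A \in @upper_tri K -> B \in @upper_tri K -> A *m B \in @upper_tri K.
Proof.
move=> /upper_triP hA /upper_triP hB; apply/upper_triP => i j ij.
rewrite mxE big1 // => k _.
case: (ltnP k i) => [/hA->|ik]; first by rewrite mul0r.
by rewrite hB ?mulr0 // (leq_trans ij).
Qed.

Lemma ut3_brk_subproof (K : fieldType) (a b : UT3 K) :
  a *m b - b *m a \in @upper_tri K.
Proof. by rewrite rpredB ?upper_tri_mul ?ut3_mxP. Qed.

Definition ut3_brk (K : fieldType) (a b : UT3 K) : UT3 K :=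
  MkUT3 (ut3_brk_subproof a b).

Section UT3Lie.
Variable K : fieldType.
Implicit Types a b c : UT3 K.

Lemma ut3_brkDl a b c : ut3_brk (a + b) c = ut3_brk a c + ut3_brk b c.
Proof. by apply: val_inj; rewrite /= mulmxDl mulmxDr opprD addrACA. Qed.
Lemma ut3_brkDr a b c : ut3_brk a (b + c) = ut3_brk a b + ut3_brk a c.
Proof. by apply: val_inj; rewrite /= mulmxDl mulmxDr opprD addrACA. Qed.
Lemma ut3_brkZl (k : K) a b : ut3_brk (k *: a) b = k *: ut3_brk a b.
Proof. by apply: val_inj; rewrite /= -scalemxAl -scalemxAr scalerBr. Qed.
Lemma ut3_brkZr (k : K) a b : ut3_brk a (k *: b) = k *: ut3_brk a b.
Proof. by apply: val_inj; rewrite /= -scalemxAl -scalemxAr scalerBr. Qed.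
Lemma ut3_brkxx a : ut3_brk a a = 0.
Proof. by apply: val_inj; rewrite /= subrr. Qed.
Lemma ut3_jacobi a b c :
  ut3_brk (ut3_brk a b) c + ut3_brk (ut3_brk b c) a
    + ut3_brk (ut3_brk c a) b = 0.
Proof.
apply: val_inj => /=; move: (ut3_mx a) (ut3_mx b) (ut3_mx c) => A B C.
rewrite !(mulmxBl, mulmxBr) !mulmxA.
move: (A *m B *m C) (A *m C *m B) (B *m A *m C) (B *m C *m A)
  (C *m A *m B) (C *m B *m A) => p1 p2 p3 p4 p5 p6.
by apply/matrixP => i j; rewrite !mxE; ring.
Qed.

HB.instance Definition _ := Lmodule_isLie.Build K (UT3 K)
  ut3_brkDl ut3_brkDr ut3_brkZl ut3_brkZr ut3_brkxx ut3_jacobi.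
End UT3Lie.

(* Degree of the matrix unit e_ij, i <= j (indices here start from 0); the    *)
(* value below the diagonal is irrelevant.                                    *)
Definition unit_deg (i j : 'I_3) : G :=
  match val i, val j with
  | 0%N, 1%N => eone
  | 1%N, 2%N => etwo
  | 0%N, 2%N => eone + etwo
  | _, _ => 0
  end.

(* The grading Gamma(e_1, e_2): the component of degree g is the span of the  *)
(* matrix units of degree g.                                                  *)
Definition Gamma (K : fieldType) (g : G) : set (UT3 K) :=
  [set a | forall i j, a i j != 0 -> unit_deg i j = g].
Arguments Gamma : clear implicits.

Definition SuppGamma : set G := [set 0; eone; etwo; eone + etwo].

Definition IdG_UT3 (K : fieldType) : set (LXG K) :=
  [set f | forall phi : {linear LXG K -> UT3 K},
     graded_hom (@LXG_comp K) (Gamma K) phi -> phi f = 0].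

Lemma SuppGammaE (K : fieldType) :
  SuppGamma = [set g | exists2 a : UT3 K, Gamma K g a & a != 0].
Proof.
have unit_in (i j : 'I_3) : (i <= j)%N ->
    exists2 a : UT3 K, Gamma K (unit_deg i j) a & a != 0.
  move=> ij; have ut : delta_mx i j \in @upper_tri K.
    apply/upper_triP => k l lk; rewrite mxE.
    by case: eqP => //= ki; case: eqP => //= lj; move: lk; rewrite ki lj ltnNge ij.
  exists (MkUT3 ut).
    move=> k l /=; rewrite mxE; case: (eqVneq k i) => [->|_]; last by rewrite eqxx.
    by case: (eqVneq l j) => [->|_] //; rewrite eqxx.
  apply/eqP => /(congr1 (fun a : UT3 K => a i j)) /=.
  by rewrite !mxE !eqxx => /eqP; rewrite oner_eq0.
apply/seteqP; split=> g /=.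
  case=> [[[->|->]|->]|->].
  - exact: (unit_in 0 0).
  - exact: (unit_in 0 1).
  - exact: (unit_in 1 (Ordinal (isT : 2 < 3)%N)).
  - exact: (unit_in 0 (Ordinal (isT : 2 < 3)%N)).
case=> a ga /eqP/eqP a0; have [i [j aij]] : exists i j, a i j != 0.
  apply: contrapT => h; case/negP: a0; apply/eqP/val_inj/matrixP => i j /=.
  rewrite mxE; apply/eqP; apply: contrapT => /negP aij; apply: h.
  by exists i, j.
rewrite -(ga _ _ aij) /SuppGamma /unit_deg /=.
by case: i j {aij} => [[|[|[|?]]] ?] [[|[|[|?]]] ?] //=; auto.
Qed.

Lemma Gamma_brk (K : fieldType) (g h : G) (a b : UT3 K) :
  Gamma K g a -> Gamma K h b -> Gamma K (g + h) (brk a b).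
Proof.
have aux (g' h' : G) (c d : UT3 K) : Gamma K g' c -> Gamma K h' d ->
    forall i j, (c *m d) i j != 0 -> unit_deg i j = g' + h'.
  move=> gc hd i j; rewrite mxE => cd.
  have [k] : exists k, c i k * d k j != 0.
    apply: contrapT => n; case/negP: cd; apply/eqP/big1 => k _.
    by apply/eqP; apply: contrapT => /negP ?; apply: n; exists k.
  rewrite mulf_eq0 negb_or => /andP[cik dkj].
  rewrite -(gc _ _ cik) -(hd _ _ dkj).
  have ik : (i <= k)%N.
    by rewrite leqNgt; apply: contra cik => /(upper_triP _ (ut3_mxP c)) ->.
  have kj : (k <= j)%N.
    by rewrite leqNgt; apply: contra dkj => /(upper_triP _ (ut3_mxP d)) ->.
  move: i j k ik kj {cd cik dkj} => [[|[|[|?]]] ?] [[|[|[|?]]] ?] [[|[|[|?]]] ?] //= _ _;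
  by rewrite /unit_deg /= ?addr0 ?add0r.
move=> ga hb i j /=; rewrite !mxE => ab.
have [e|e] := eqVneq ((a *m b) i j) 0; last exact: (aux _ _ a b).
rewrite addrC; apply: (aux _ _ b a) => //; move: ab e; rewrite !mxE => ab e.
by apply: contraNneq ab => e'; rewrite e e' subrr.
Qed.

(* x_g stands for x_{0,g}, and y_1, y_2, ... for all the variables            *)
(* x_{0,1}, x_{1,1}, ... of trivial degree. In an identity the choice of the  *)
(* variables is immaterial, a T_G-ideal being closed under renaming them.     *)
Definition identities (K : fieldType) : set (LXG K) :=
  [set xvar K 0 g | g in ~` SuppGamma] `|`
  [set brk (yvar K 0) (yvar K 1)] `|`
  [set f | exists q : nat, [set: K] #= `I_q /\
     exists2 g, [set eone; etwo; eone + etwo] g &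
       f = lnorm (xvar K 0 g) (nseq q (yvar K 0))
           - brk (xvar K 0 g) (yvar K 0)].

(* p < |K|, as a comparison of cardinals: no condition when K is infinite. *)
Definition lt_card (K : fieldType) (p : nat) : Prop := ~ ([set: K] #<= `I_p).

(* The list y_1^(p_1), ..., y_r^(p_r). *)
Definition ypow (K : fieldType) (r : nat) (p : 'I_r -> nat) : seq (LXG K) :=
  flatten [seq nseq (p l) (yvar K l) | l <- enum 'I_r].

Definition basis1 (K : fieldType) : set (LXG K) :=
  [set f | exists i g r (p : 'I_r -> nat),
     [/\ [set eone; etwo; eone + etwo] g,
         forall l, lt_card K (p l)
       & f = lnorm (xvar K i g) (ypow K p)]].

Definition basis2 (K : fieldType) : set (LXG K) :=
  [set f | exists i j r (p q : 'I_r -> nat),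
     [/\ forall l, lt_card K (p l),
         forall l, lt_card K (q l)
       & f = lnorm (xvar K i eone) (ypow K p ++ xvar K j etwo :: ypow K q)]].

(* The variables of trivial degree span the component of degree 1 modulo the  *)
(* identities, a component that the commutators of basis1 and basis2, all of  *)
(* nontrivial degree, do not reach.                                           *)
Definition basis0 (K : fieldType) : set (LXG K) := range (yvar K).

(* The images of the elements of B form a basis of the quotient L / I, and    *)
(* distinct elements of B have distinct images.                               *)
Definition basis_modulo (K : fieldType) (L : lmodType K) (I B : set L) : Prop :=
  (forall f, exists (s : seq L) (c : L -> K),
     (forall b, b \in s -> B b) /\ I (f - \sum_(b <- s) c b *: b)) /\
  (forall (s : seq L) (c : L -> K), uniq s -> (forall b, b \in s -> B b) ->
     I (\sum_(b <- s) c b *: b) -> forall b, b \in s -> c b = 0).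

Arguments IdG_UT3 : clear implicits.
Arguments identities : clear implicits.
Arguments basis0 : clear implicits.
Arguments basis1 : clear implicits.
Arguments basis2 : clear implicits.

(* Main.v *)
(* Modulo the T_G-ideal J generated by the identities, the variables of       *)
(* trivial degree act by commuting maps, all brackets of degree outside the   *)
(* support vanish, and over a field with q elements (ad y)^q = ad y; hence    *)
(* sorted words with exponents smaller than |K| span. Conversely, at a        *)
(* generic graded point with y_l = diag(0, t_l, s_l) the words of degree e_1  *)
(* and e_1 e_2 evaluate to distinct monomials in the coordinates (those of    *)
(* degree e_2 do so once all t_l = 0), and monomial functions with exponents  *)
(* smaller than |K| are linearly independent. So the spanning words are a     *)
(* basis modulo Id_G, and as J is contained in Id_G the two ideals coincide.  *)

Require Import Defs.
From mathcomp Require Import all_boot all_order all_algebra.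
From mathcomp Require Import all_classical.

Set Implicit Arguments.
Unset Strict Implicit.
Unset Printing Implicit Defensive.

Import GRing.Theory.
Local Open Scope ring_scope.
Local Open Scope classical_set_scope.
Local Open Scope card_scope.

(** Let J be the [TG_generated] ideal of the identities. The proof is a squeeze: J is contained in
    Id_G ([identities_IdG]), the proposed elements span the free algebra modulo J ([spanned_all]),
    and they are independent modulo the larger ideal Id_G ([basis_free]). An element of Id_G is
    then, modulo J, a combination of basis elements lying in Id_G; its coefficients vanish, so the
    element is in J.

    Spanning: the span plus J contains the variables and is closed under brackets. This is a
    multiplication table ([spanned_brk_basis]) resting on the normal form of words in the y's
    ([word_reduction]) and on left-norming a product of words of degrees e_1 and e_2
    ([spanned_brk_words]).

    Independence: a diagonal matrix acts on each matrix unit by a scalar ([brk_diag]), so at a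
    generic graded point each basis element has a monomial as its relevant entry
    ([generic_eval_bcode]). Distinct monomials with exponents below |K| are independent functions
    ([words_free]). Finite and infinite fields are treated together through [lt_card]. *)

(** * Exponents below |K|: enumerations, Frobenius, polynomial functions *)

Section CardinalityBounds.
Variable K : fieldType.

Lemma card_setT_seq q : [set: K] #= `I_q ->
  exists2 rs : seq K, uniq rs & size rs = q /\ forall x, x \in rs.
Proof.
move/card_set_bijP => [f [fI finj fsurj]].
have g_spec i : exists x, (i < q)%N -> f x = i.
  have [iq|] := boolP (i < q)%N; last by exists 0.
  by have [x _ fx] := fsurj i iq; exists x.
have [g gK] := choice g_spec.
exists [seq g i | i <- iota 0 q].
  rewrite map_inj_in_uniq ?iota_uniq // => i j.
  by rewrite !mem_iota /= !add0n => /gK fi /gK fj gij; rewrite -fi -fj gij.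
split=> [|x]; first by rewrite size_map size_iota.
have fxq : (f x < q)%N by apply: fI.
apply/mapP; exists (f x); first by rewrite mem_iota.
by apply: finj; rewrite ?inE // gK.
Qed.

Lemma card_setT_le_seq (rs : seq K) n :
  (forall x, x \in rs) -> (size rs <= n)%N -> [set: K] #<= `I_n.
Proof.
move=> rsT rsn.
have idx_inj : {in [set: K] &, injective (index^~ rs)}.
  by move=> x y _ _ xy; rewrite -(nth_index 0 (rsT x)) xy nth_index.
apply: (card_le_trans (B := [set index x rs | x in [set: K]])).
  by move: (inj_card_eq idx_inj); rewrite card_eq_le => /andP[].
apply: subset_card_le => _ [x _ <-] /=.
by apply: leq_trans rsn; rewrite index_mem.
Qed.

(** An exponent can violate the bound only over a finite field; this supplies the q for which
    identity (iii) is available, small enough to be applied. *)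
Lemma not_lt_card p : ~ lt_card K p ->
  exists2 q : nat, (q <= p)%N & [set: K] #= `I_q.
Proof.
move=> /contrapT Kp.
have /finite_setP[q Kq] : finite_set [set: K].
  exact: (card_le_finite Kp (finite_II p)).
exists q => //; rewrite -card_le_II.
by apply: card_le_trans Kp; move: Kq; rewrite card_eq_le => /andP[].
Qed.

Lemma lt_cardW p p' : (p' <= p)%N -> lt_card K p -> lt_card K p'.
Proof.
by move=> p'p Kp Kp'; apply: Kp; apply: (card_le_trans Kp'); rewrite card_le_II.
Qed.

Lemma lt_card1 : lt_card K 1.
Proof.
move=> K1; have [//|q q1 /card_setT_seq[rs _ [rsq rsT]]] := @not_lt_card 1.
have := rsT 0; have := rsT 1; case: rs rsq {rsT} => [//|x [|y rs]] //= sz.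
  by rewrite !inE => /eqP <- /eqP/esym/eqP; rewrite oner_eq0.
by move: q1; rewrite -sz.
Qed.

Lemma card_gt1 q : [set: K] #= `I_q -> (1 < q)%N.
Proof.
move=> Kq; rewrite ltnNge; apply/negP => q1.
by apply: (lt_cardW q1 lt_card1); move: Kq; rewrite card_eq_le => /andP[].
Qed.

(** A list of n distinct elements that could not be extended would enumerate the field and bound its
    cardinality by n. *)
Lemma lt_card_uniq n : lt_card K n -> exists2 rs : seq K, uniq rs & size rs = n.+1.
Proof.
elim: n => [|n IHn] Kn; first by exists [:: 0].
have [//|rs rsU rsn] := IHn (lt_cardW (leqnSn n) _).
have [x xrs] : exists x, x \notin rs.
  apply: contrapT => /forallNP rsT; apply: Kn; apply: (@card_setT_le_seq rs).
    by move=> x; apply: contrapT => /negP xrs; exact: (rsT x).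
  by rewrite rsn.
by exists (x :: rs); rewrite /= ?xrs ?rsn.
Qed.

(** Multiplication by a nonzero t permutes the nonzero elements; comparing their product before and
    after gives t^(q-1) = 1. *)
Lemma expf_card_seq (rs : seq K) (t : K) :
  uniq rs -> (forall x, x \in rs) -> t ^+ size rs = t.
Proof.
move=> rsU rsT; have [->|t0] := eqVneq t 0.
  by rewrite expr0n; case: rs rsT {rsU} => // /(_ 0).
pose us := rem 0 rs.
have usE x : (x \in us) = (x != 0) by rewrite mem_rem_uniq // inE rsT andbT.
have usU : uniq us by rewrite rem_uniq.
have us_perm : perm_eq [seq t * x | x <- us] us.
  apply: uniq_perm => //; first by rewrite map_inj_uniq //; apply: mulfI.
  move=> x; rewrite usE; apply/mapP/idP => [[y]|x0].
    by rewrite usE => y0 ->; rewrite mulf_neq0.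
  by exists (t^-1 * x); rewrite ?usE ?mulf_neq0 ?invr_eq0 // mulVKf.
have : \prod_(x <- us) x = \prod_(x <- [seq t * x | x <- us]) x.
  exact/esym/perm_big.
rewrite big_map big_split /=.
rewrite big_const_seq count_predT iter_mulr_1 -[LHS]mul1r => /mulIf tus.
have -> : size rs = (size us).+1 by rewrite (perm_size (perm_to_rem (rsT 0))).
rewrite exprS -tus ?mulr1 //; rewrite prodf_seq_neq0.
by apply/allP => x; rewrite usE => ->.
Qed.

Lemma card_expf q (t : K) : [set: K] #= `I_q -> t ^+ q = t.
Proof. by move=> /card_setT_seq[rs rsU [<- rsT]]; apply: expf_card_seq. Qed.

(** The degree itself is an exponent below |K|, so a nonzero p would have more distinct roots than
    its degree allows. *)
Lemma poly_fun_eq0 (p : {poly K}) :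
  (forall i, p`_i != 0 -> lt_card K i) -> (forall x, p.[x] = 0) -> p = 0.
Proof.
move=> pK px; apply/eqP; apply: contrapT => /negP p0.
have [rs rsU rsn] : exists2 rs : seq K, uniq rs & size rs = (size p).-1.+1.
  by apply: lt_card_uniq; apply: pK; rewrite -lead_coefE lead_coef_eq0.
have := max_poly_roots p0 _ rsU; rewrite rsn prednK ?size_poly_gt0 // ltnn.
by move=> /(_ _)/negP; apply => //; apply/allP => x _; apply/eqP.
Qed.

End CardinalityBounds.

(** * Linear independence of monomial functions *)

(* Induction on the variables: for fixed values of the others, the sum is a  *)
(* polynomial in the first one, of degree smaller than |K|.                  *)
Lemma monomials_free (K : fieldType) (T I : eqType) (V : seq T)
    (s : seq I) (m : I -> T -> nat) (c : I -> K) :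
  uniq V -> uniq s ->
  (forall i v, i \in s -> lt_card K (m i v)) ->
  (forall i j, i \in s -> j \in s -> {in V, m i =1 m j} -> i = j) ->
  (forall x : T -> K, \sum_(i <- s) c i * \prod_(v <- V) x v ^+ m i v = 0) ->
  forall i, i \in s -> c i = 0.
Proof.
elim: V s => [|v V IHV] s /= => [_ sU _ minj c0 i si|/andP[vV VU] sU mK minj c0 i si].
  have sE : s = [:: i].
    apply: perm_small_eq => //; apply: uniq_perm => // j; rewrite inE.
    apply/idP/eqP => [sj|->//]; exact: minj.
  by have := c0 (fun=> 0); rewrite sE big_seq1 big_nil mulr1.
apply: (IHV [seq j <- s | m j v == m i v]) => //.
- exact: filter_uniq.
- by move=> j w; rewrite mem_filter => /andP[_ /mK].
- move=> j k; rewrite !mem_filter => /andP[/eqP jv js] /andP[/eqP kv ks] jk.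
  by apply: minj => // w; rewrite inE => /predU1P[->|/jk//]; rewrite jv kv.
(* The coefficient of [p] at [m i v] is the subsum over the indices sharing the exponent of [i] in
   [v], which is the sum the induction hypothesis needs to vanish. *)
- move=> x; pose p : {poly K} :=
    \sum_(j <- s) (c j * \prod_(w <- V) x w ^+ m j w) *: 'X^(m j v).
  have pE k : p`_k = \sum_(j <- s | m j v == k) c j * \prod_(w <- V) x w ^+ m j w.
    rewrite /p coef_sum [RHS]big_mkcond /=; apply: eq_bigr => j _.
    by rewrite coefZ coefXn eq_sym; case: ifP => _; rewrite ?mulr1 ?mulr0.
  rewrite big_filter -pE (@poly_fun_eq0 _ p) ?coef0 // => [k|a].
    rewrite pE => pk; apply: contrapT => Kk; move: pk; rewrite big_seq_cond big1 ?eqxx //.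
    by move=> j /andP[sj /eqP jk]; case: Kk; rewrite -jk; apply: mK.
  rewrite -[RHS](c0 (fun w => if w == v then a else x w)) horner_sum.
  apply: eq_bigr => j _; rewrite hornerZ hornerXn big_cons eqxx -mulrA [_ * a ^+ _]mulrC.
  congr (_ * _); congr (_ * _); rewrite big_seq [RHS]big_seq; apply: eq_bigr => w wV.
  by rewrite (negPf (memPn vV w wV)).
by rewrite mem_filter eqxx.
Qed.

Lemma prod_count_mem (K : fieldType) (T : eqType) (V w : seq T) (x : T -> K) :
  uniq V -> {subset w <= V} ->
  \prod_(v <- V) x v ^+ count_mem v w = \prod_(v <- w) x v.
Proof.
move=> VU wV; rewrite -[RHS]prodr_undup_exp_count [LHS](bigID (mem w)) /=.
rewrite [X in _ * X]big1 ?mulr1 => [|v /count_memPn ->//].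
rewrite -[LHS]big_filter; apply: perm_big; apply: uniq_perm; rewrite ?filter_uniq ?undup_uniq //.
by move=> v; rewrite mem_filter mem_undup; case: (boolP (v \in w)) => // /wV ->.
Qed.

Lemma words_free (K : fieldType) (T I : eqType) (s : seq I) (w : I -> seq T)
    (c : I -> K) :
  uniq s -> (forall i v, i \in s -> lt_card K (count_mem v (w i))) ->
  (forall i j, i \in s -> j \in s -> perm_eq (w i) (w j) -> i = j) ->
  (forall x : T -> K, \sum_(i <- s) c i * \prod_(v <- w i) x v = 0) ->
  forall i, i \in s -> c i = 0.
Proof.
move=> sU wK winj c0; pose V := undup (flatten [seq w i | i <- s]).
have wV i : i \in s -> {subset w i <= V}.
  by move=> si v vi; rewrite mem_undup; apply/flatten_mapP; exists i.
apply: (@monomials_free _ _ _ V s (fun i v => count_mem v (w i))) => //.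
- exact: undup_uniq.
- move=> i j si sj ij; apply: winj => //; apply/allP => v.
  by rewrite mem_cat => /orP[/(wV i si)/ij|/(wV j sj)/ij] /= ->.
- move=> x; rewrite -[RHS](c0 x) big_seq [RHS]big_seq; apply: eq_bigr => i si.
  by rewrite prod_count_mem ?undup_uniq //; apply: wV.
Qed.

(** * Elementary identities in Lie algebras *)

Section LieAlgebraFacts.
Variables (K : fieldType) (L : lieAlgType K).
Implicit Types (x y z u v : L) (s t : seq L).

Lemma brk0l x : brk 0 x = 0 :> L.
Proof. by rewrite -[X in brk X](scale0r 0) brkZl scale0r. Qed.

Lemma brk0r x : brk x 0 = 0 :> L.
Proof. by rewrite -[X in brk _ X](scale0r 0) brkZr scale0r. Qed.

Lemma brkNl x y : brk (- x) y = - brk x y.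
Proof. by rewrite -scaleN1r brkZl scaleN1r. Qed.

Lemma brkNr x y : brk x (- y) = - brk x y.
Proof. by rewrite -scaleN1r brkZr scaleN1r. Qed.

Lemma brkC x y : brk x y = - brk y x.
Proof.
apply/eqP; rewrite -addr_eq0; have := brkxx (x + y).
by rewrite brkDl !brkDr !brkxx add0r addr0 => ->.
Qed.

(** The Jacobi identity in the form that turns nested brackets into left-normed ones. *)
Lemma brk_brkr x y z : brk x (brk y z) = brk (brk x y) z - brk (brk x z) y.
Proof.
have /eqP := brk_jacobi x y z; rewrite [brk z x]brkC brkNl.
by rewrite [brk (brk y z) x]brkC addrAC subr_eq0 => /eqP <-.
Qed.

Lemma lnormB u v s : lnorm u s - lnorm v s = lnorm (u - v) s.
Proof.
elim: s u v => // z s IHs u v; apply: etrans (IHs _ _) _.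
by rewrite -brkNl -brkDl.
Qed.

Lemma lnorm_cat u s t : lnorm u (s ++ t) = lnorm (lnorm u s) t.
Proof. exact: foldl_cat. Qed.

Lemma lie_idealB (I : set L) x y : lie_ideal I -> I x -> I y -> I (x - y).
Proof. by case=> _ ID IZ _ Ix Iy; rewrite -scaleN1r; apply/ID/IZ. Qed.

Lemma lie_ideal_lnorm (I : set L) u s : lie_ideal I -> I u -> I (lnorm u s).
Proof. by case=> _ _ _ IM; elim: s u => // z s IHs u /IM Iuz; apply: IHs. Qed.

End LieAlgebraFacts.

(** * Graded homomorphisms from the free algebra and generated ideals *)

Section GradedSubstitutions.
Variable K : fieldType.

Lemma graded_hom_lift (M : lieAlgType K) (gM : G -> set M) (f : nat * G -> M) :
  (forall g, gM g 0) ->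
  (forall g x y, gM g x -> gM g y -> gM g (x + y)) ->
  (forall g a x, gM g x -> gM g (a *: x)) ->
  (forall g h x y, gM g x -> gM h y -> gM (g + h) (brk x y)) ->
  (forall i g, gM g (f (i, g))) ->
  @graded_hom K (LXG K) M (@LXG_comp K) gM (fl_lift f).
Proof.
move=> g0 gD gZ gB gf; split=> [|g x]; first exact: fl_lift_hom.
elim=> {g x} [i g|g|g x y _ IHx _ IHy|g a x _ IHx|g h x y _ IHx _ IHy].
- by rewrite /= fl_lift_var.
- by rewrite linear0.
- by rewrite linearD; apply: gD.
- by rewrite linearZ; apply: gZ.
- by rewrite fl_lift_hom; apply: gB.
Qed.

Lemma graded_subst (f : nat * G -> LXG K) :
  (forall i g, LXG_comp g (f (i, g))) ->
  @graded_hom K (LXG K) (LXG K) (@LXG_comp K) (@LXG_comp K) (fl_lift f).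
Proof. by apply: graded_hom_lift => *; by [constructor | apply: LXG_add | apply: LXG_brk]. Qed.

Lemma graded_hom_lnorm (L M : lieAlgType K) gL gM (phi : {linear L -> M}) u s :
  graded_hom gL gM phi -> phi (lnorm u s) = lnorm (phi u) (map phi s).
Proof.
by case=> phiB _; elim: s u => // z s IHs u; apply: etrans (IHs _) _; rewrite phiB.
Qed.

Lemma TG_generated_ideal (S : set (LXG K)) : TG_ideal (TG_generated S).
Proof.
split; first split.
- by move=> J [[[]]].
- move=> x y Ix Iy J SJ; have [[[_ JD _ _] _] _] := SJ.
  by apply: JD; [apply: Ix | apply: Iy].
- move=> a x Ix J SJ; have [[[_ _ JZ _] _] _] := SJ.
  by apply: JZ; apply: Ix.
- move=> x y Ix J SJ; have [[[_ _ _ JB] _] _] := SJ.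
  by apply: JB; apply: Ix.
- move=> f fgr x Ix J SJ; have [[_ Jf] _] := SJ.
  by apply: Jf => //; apply: Ix.
Qed.

Lemma SuppGammaP g : SuppGamma g <-> g \in [:: 0; eone; etwo; eone + etwo].
Proof.
rewrite /SuppGamma !inE; split=> [[[[->|->]|->]|->]|]; rewrite ?eqxx ?orbT //.
by move=> /or4P[] /eqP ->; [do 3 left | do 2 left; right | left; right | right].
Qed.

End GradedSubstitutions.

(** * Normal forms of words in the y's and codes for basis elements *)

Section ReducedWords.
Variable K : fieldType.
Implicit Types (s : seq nat).

(** A reduced word encodes an exponent vector independently of r: padding with zero exponents leaves
    the word unchanged. *)
Definition reduced s := sorted leq s /\ forall l, lt_card K (count_mem l s).

Definition ymap s : seq (LXG K) := [seq yvar K l | l <- s].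

Definition power_word (P : nat -> nat) s := flatten [seq nseq (P l) l | l <- s].

Lemma count_power_word P s l : uniq s ->
  count_mem l (power_word P s) = if l \in s then P l else 0%N.
Proof.
rewrite /power_word; elim: s => //= k s IHs /andP[ks sU].
rewrite count_cat IHs // count_nseq in_cons /=; have [->|_] := eqVneq l k.
  by rewrite mul1n (negPf ks) addn0.
by rewrite mul0n.
Qed.

Lemma sorted_power_word P m n : sorted leq (power_word P (iota m n)).
Proof.
rewrite sorted_pairwise; last exact: leq_trans.
elim: n m => //= n IHn m; rewrite /power_word /= pairwise_cat IHn andbT.
apply/andP; split.
  apply/allrelP => k l /nseqP[-> _] /flattenP[_ /mapP[j + ->]] /nseqP[-> _].
  by rewrite mem_iota => /andP[/ltnW].
by elim: (P m) => //= k ->; rewrite andbT; apply/allP => l /nseqP[->].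
Qed.

Lemma ypowE r (p : 'I_r -> nat) :
  ypow K p =
    ymap (power_word (fun l => if insub l is Some l' then p l' else 0%N) (iota 0 r)).
Proof.
rewrite /ypow /ymap /power_word -val_enum_ord -map_comp map_flatten -map_comp.
congr flatten; apply: eq_map => l /=.
by rewrite map_nseq valK.
Qed.

Lemma ypow_reduced r (p : 'I_r -> nat) :
  (forall l, lt_card K (p l)) -> exists2 s, reduced s & ypow K p = ymap s.
Proof.
move=> pK; have K0 := lt_cardW (leq0n 1) (@lt_card1 K).
rewrite ypowE; eexists; last by [].
split=> [|l]; first exact: sorted_power_word.
rewrite count_power_word ?iota_uniq //.
by case: ifP => // _; case: insubP.
Qed.

Lemma reduced_ypow s r : reduced s -> (forall l, l \in s -> (l < r)%N) ->
  exists2 p : 'I_r -> nat, (forall l, lt_card K (p l)) & ymap s = ypow K p.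
Proof.
move=> [sS sK] sr.
exists (fun l => count_mem (val l) s) => [l|]; first exact: sK.
rewrite ypowE; congr ymap; apply: (sorted_eq leq_trans anti_leq) => //.
  exact: sorted_power_word.
apply/allP => l _ /=; apply/eqP; rewrite count_power_word ?iota_uniq //.
rewrite mem_iota /= add0n; case: ifPn => lr; first by rewrite insubT.
by apply/count_memPn; apply: contra lr; apply: sr.
Qed.

Lemma seq_nat_bound s : exists r, forall l, l \in s -> (l < r)%N.
Proof.
by exists (\max_(l <- s) l).+1 => l ls; rewrite ltnS; apply: (leq_bigmax_seq (F := id)).
Qed.

(** Combinatorial data naming a basis element, so that its degree and its generic value can be
    defined by cases, which the element of the quotient does not permit. *)
Inductive bcode :=
| BY of nat
| B1 of nat & seq nat
| B2 of nat & seq nat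
| B3 of nat & seq nat
| B12 of nat & nat & seq nat & seq nat.

Definition bcode_elt (c : bcode) : LXG K :=
  match c with
  | BY l => yvar K l
  | B1 i s => lnorm (xvar K i eone) (ymap s)
  | B2 i s => lnorm (xvar K i etwo) (ymap s)
  | B3 i s => lnorm (xvar K i (eone + etwo)) (ymap s)
  | B12 i j s t => lnorm (xvar K i eone) (ymap s ++ xvar K j etwo :: ymap t)
  end.

Definition bcode_wf (c : bcode) : Prop :=
  match c with
  | BY _ => True
  | B1 _ s | B2 _ s | B3 _ s => reduced s
  | B12 _ _ s t => reduced s /\ reduced t
  end.

Definition bcode_deg (c : bcode) : G :=
  match c with
  | BY _ => 0
  | B1 _ _ => eone
  | B2 _ _ => etwo
  | B3 _ _ | B12 _ _ _ _ => eone + etwo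
  end.

Definition basis : set (LXG K) := basis0 K `|` basis1 K `|` basis2 K.

Lemma basisP b : basis b <-> exists2 c, bcode_wf c & b = bcode_elt c.
Proof.
split.
  case=> [[[l _ <-]|]|]; first by exists (BY l).
  - move=> [i [g [r [p [g3 /ypow_reduced[s sR sE] ->]]]]]; rewrite sE.
    by case: g3 => [[->|->]|->]; [exists (B1 i s) | exists (B2 i s) | exists (B3 i s)].
  - move=> [i [j [r [p [q [/ypow_reduced[s sR sE] /ypow_reduced[t tR tE] ->]]]]]].
    by exists (B12 i j s t); rewrite //= sE tE.
have B_1 i g s : [set eone; etwo; eone + etwo] g -> reduced s ->
    basis (lnorm (xvar K i g) (ymap s)).
  move=> g3 sR; have [r sr] := seq_nat_bound s.
  have [p pK ->] := reduced_ypow sR sr.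
  by left; right; exists i, g, r, p.
case=> -[l|i s|i s|i s|i j s t] /= wf ->.
- by left; left; exists l.
- by apply: B_1 => //; left; left.
- by apply: B_1 => //; left; right.
- by apply: B_1 => //; right.
have [sR tR] := wf; have [r str] := seq_nat_bound (s ++ t).
have [|p pK ->] := @reduced_ypow s r sR; first by move=> l ls; rewrite str ?mem_cat ?ls.
have [|q qK ->] := @reduced_ypow t r tR; first by move=> l lt; rewrite str ?mem_cat ?lt ?orbT.
by right; exists i, j, r, p, q.
Qed.

End ReducedWords.

(** * The basis elements span modulo the generated ideal *)

Section Spanning.
Variable K : fieldType.
Local Notation I := (TG_generated (identities K)).
Local Notation three := [set eone; etwo; eone + etwo].
Local Notation comp := (@LXG_comp K).
Local Notation y := (yvar K).
Implicit Types (u v : LXG K) (s t : seq nat).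

Let I_ideal : lie_ideal I. Proof. by have [] := TG_generated_ideal (identities K). Qed.
Let I0 : I 0. Proof. by have [] := I_ideal. Qed.
Let ID u v : I u -> I v -> I (u + v). Proof. by have [_ H _ _] := I_ideal; apply: H. Qed.
Let IZ a u : I u -> I (a *: u). Proof. by have [_ _ H _] := I_ideal; apply: H. Qed.
Let IM u v : I u -> I (brk u v). Proof. by have [_ _ _ H] := I_ideal; apply: H. Qed.
Let IN u : I u -> I (- u). Proof. by move=> /(IZ (-1)); rewrite scaleN1r. Qed.

(** The identities are stated for fixed variables; invariance under graded endomorphisms extends
    them to homogeneous elements of the same degrees. *)
Lemma identities_subst (f : nat * G -> LXG K) u :
  (forall i g, comp g (f (i, g))) -> identities K u -> I (fl_lift f u).
Proof.
move=> fgr uid; have [_ Isub] := TG_generated_ideal (identities K).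
apply: (Isub (fl_lift f)); first exact: graded_subst.
exact: (sub_smallest (fun _ => id)).
Qed.

Definition override (x : nat * G) u (f : nat * G -> LXG K) : nat * G -> LXG K :=
  fun z => if z == x then u else f z.

Lemma override_graded x u f : comp x.2 u -> (forall i g, comp g (f (i, g))) ->
  forall i g, comp g (override x u f (i, g)).
Proof. by move=> xu fgr i g; rewrite /override; case: eqP => // xE; rewrite -xE in xu. Qed.

Lemma comp_var i g : comp g (fl_var K (i, g)). Proof. exact: LXG_var. Qed.
Hint Resolve comp_var : core.

Lemma comp_brk_y g u l : comp g u -> comp g (brk u (y l)).
Proof. by move=> gu; rewrite -[g]addr0; apply: LXG_brk gu (LXG_var _ _ _). Qed.

Lemma comp_lnorm g u s : comp g u -> comp g (lnorm u (ymap K s)).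
Proof. by elim: s u => // l s IHs u gu; apply: IHs; apply: comp_brk_y. Qed.

Lemma ideal_deg g u : comp g u -> ~ SuppGamma g -> I u.
Proof.
move=> gu gS; have := @identities_subst (override (0%N, g) u (@fl_var K _)) (xvar K 0 g).
rewrite /= fl_lift_var /override eqxx; apply; first exact: override_graded.
by left; left; exists g.
Qed.

Lemma ideal_yy k l : I (brk (y k) (y l)).
Proof.
pose f := override (0%N, 0) (y k) (override (1%N, 0) (y l) (@fl_var K _)).
have := @identities_subst f (brk (y 0) (y 1)).
rewrite fl_lift_hom /= !fl_lift_var; apply; last by left; right.
by apply: override_graded; [exact: LXG_var | apply: override_graded => //; exact: LXG_var].
Qed.

Lemma ideal_frobenius q g u l : [set: K] #= `I_q -> three g -> comp g u ->
  I (lnorm u (nseq q (y l)) - brk u (y l)).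
Proof.
(* Since g is nontrivial, x_{0,g} and y_0 are different variables and can be substituted
   independently. *)
move=> Kq g3 gu; have g0 : (0 == g :> G) = false by case: g3 => [[->|->]|->].
pose f := override (0%N, g) u (override (0%N, 0) (y l) (@fl_var K _)).
have fgr : forall i h, comp h (f (i, h)).
  by apply: override_graded => //; apply: override_graded => //; exact: LXG_var.
have := @identities_subst f (lnorm (xvar K 0 g) (nseq q (y 0)) - brk (xvar K 0 g) (y 0)) fgr.
rewrite linearB fl_lift_hom (graded_hom_lnorm _ _ (graded_subst fgr)) /= map_nseq.
rewrite !fl_lift_var /f /override !eqxx xpair_eqE /= g0; apply.
by right; exists q; split => //; exists g.
Qed.

Definition eqm u v := I (u - v).

Lemma eqm_refl u : eqm u u. Proof. by rewrite /eqm subrr. Qed.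

Lemma eqm_trans v u w : eqm u v -> eqm v w -> eqm u w.
Proof. by move=> uv vw; rewrite /eqm -(subrKA v); apply: ID. Qed.

Lemma eqm_lnorm u v (Y : seq (LXG K)) : eqm u v -> eqm (lnorm u Y) (lnorm v Y).
Proof. by rewrite /eqm lnormB; apply: lie_ideal_lnorm. Qed.

(** By Jacobi the difference is [u, [y_k, y_l]], a multiple of identity (ii). *)
Lemma eqm_swap u k l : eqm (brk (brk u (y k)) (y l)) (brk (brk u (y l)) (y k)).
Proof. by rewrite /eqm -brk_brkr brkC; exact: (IN (IM _ (ideal_yy _ _))). Qed.

Lemma eqm_perm u s t : perm_eq s t -> eqm (lnorm u (ymap K s)) (lnorm u (ymap K t)).
Proof.
elim: s t u => [|l s IHs] t u st.
  by move: st; rewrite perm_sym => /perm_nilP ->; apply: eqm_refl.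
have : l \in t by rewrite -(perm_mem st) mem_head.
move: st => /[swap] /splitPr[t1 t2] st.
have {}st : perm_eq s (t1 ++ t2).
  by rewrite -(perm_cons l) (permPl st) -(cat1s l t2) -(cat1s l (t1 ++ t2)) perm_catCA.
apply: (eqm_trans (IHs _ (brk u (y l)) st)) => {s IHs st}.
(* The letter [l] moves from the front past [t1] by adjacent swaps. *)
elim: t1 u => [|k t1 IHt] u; first exact: eqm_refl.
apply: (@eqm_trans (lnorm (brk (brk u (y k)) (y l)) (ymap K (t1 ++ t2)))).
  exact: (eqm_lnorm (ymap K (t1 ++ t2)) (eqm_swap u l k)).
exact: IHt.
Qed.

(** Induction on length. A letter occurring at least q = |K| times has q of its copies brought next
    to [u], where identity (iii) replaces them by one; the word shrinks because q > 1. When no such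
    letter remains, sorting suffices. *)
Lemma word_reduction g u s : three g -> comp g u ->
  exists2 t, reduced K t & eqm (lnorm u (ymap K s)) (lnorm u (ymap K t)).
Proof.
move=> g3 gu; have [n] := ubnP (size s); elim: n s => // n IHn s sn.
have [sK|/existsNP[l /not_lt_card[q ql Kq]]] :=
    pselect (forall l, lt_card K (count_mem l s)).
  exists (sort leq s); last by apply: eqm_perm; rewrite perm_sym perm_sort.
  split=> [|l]; first by rewrite sort_sorted //; exact: leq_total.
  by rewrite (permP (permEl (perm_sort leq s))).
pose r := nseq (count_mem l s - q) l ++ [seq k <- s | k != l].
have sE : perm_eq s (nseq q l ++ r).
  rewrite catA -nseqD subnKC // perm_sym -(permPr (permEl (perm_filterC (pred1 l) s))).
  rewrite perm_cat2r; suff -> : [seq k <- s | pred1 l k] = nseq (count_mem l s) l by [].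
  by rewrite -size_filter; apply/all_pred1P/filter_all.
have [|t tR lrt] := IHn (l :: r).
  apply: leq_trans (sn : (size s <= n)%N); rewrite (perm_size sE) size_cat size_nseq.
  by rewrite -add2n leq_add2r (card_gt1 Kq).
exists t => //; apply: (eqm_trans _ lrt); apply: (eqm_trans (eqm_perm u sE)).
rewrite /ymap map_cat map_nseq lnorm_cat; apply: eqm_lnorm.
exact: ideal_frobenius Kq g3 gu.
Qed.

Definition spanned u := exists (s : seq (LXG K)) (c : LXG K -> K),
  (forall b, b \in s -> basis b) /\ I (u - \sum_(b <- s) c b *: b).

Lemma spanned_ideal u : I u -> spanned u.
Proof. by move=> Iu; exists [::], (fun=> 0); rewrite big_nil subr0. Qed.

Lemma spanned_basis b : basis b -> spanned b.
Proof.
move=> bB; exists [:: b], (fun=> 1); split=> [d|]; first by rewrite inE => /eqP ->.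
by rewrite big_seq1 scale1r subrr.
Qed.

Lemma spannedZ a u : spanned u -> spanned (a *: u).
Proof.
move=> [s [c [sB Iu]]]; exists s, (fun b => a * c b); split=> //.
have -> : \sum_(b <- s) (a * c b) *: b = a *: \sum_(b <- s) c b *: b.
  by rewrite scaler_sumr; apply: eq_bigr => b _; rewrite scalerA.
by rewrite -scalerBr; apply: IZ.
Qed.

(** Repetitions in a list are absorbed into the coefficients; this allows two combinations to be
    merged over one list, and independence to be applied to a list with repetitions. *)
Lemma sum_count_mem (V : lmodType K) (s t : seq V) (c : V -> K) :
  uniq t -> {subset s <= t} ->
  \sum_(b <- t) (c b *+ count_mem b s) *: b = \sum_(b <- s) c b *: b.
Proof.
move=> tU; elim: s => [|d s IHs] st.
  by rewrite big_nil big1 // => b _; rewrite mulr0n scale0r.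
rewrite big_cons -IHs => [|b bs]; last by apply: st; rewrite inE bs orbT.
rewrite (eq_bigr (fun b => (if b == d then c d *: d else 0) + (c b *+ count_mem b s) *: b)).
  rewrite big_split /= -big_mkcond -big_filter; congr (_ + _).
  rewrite (_ : [seq b <- t | b == d] = [:: d]) ?big_seq1 //.
  by rewrite filter_pred1_uniq // st ?mem_head.
move=> b _; rewrite /= eq_sym mulrnDr scalerDl; case: eqVneq => [->|_] //.
by rewrite mulr0n scale0r.
Qed.

Lemma spannedD u v : spanned u -> spanned v -> spanned (u + v).
Proof.
move=> [s [c [sB Iu]]] [t [d [tB Iv]]].
exists (undup (s ++ t)), (fun b => c b *+ count_mem b s + d b *+ count_mem b t).
split=> [b|]; first by rewrite mem_undup mem_cat => /orP[/sB|/tB].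
under eq_bigr => b do rewrite scalerDl.
rewrite big_split /= !sum_count_mem ?undup_uniq // => [|b bt|b bs].
- by rewrite opprD addrACA; apply: ID.
- by rewrite mem_undup mem_cat bt orbT.
- by rewrite mem_undup mem_cat bs.
Qed.

Lemma spannedN u : spanned u -> spanned (- u).
Proof. by rewrite -scaleN1r; apply: spannedZ. Qed.

Lemma spanned_eqm u v : eqm u v -> spanned v -> spanned u.
Proof. by move=> uv vS; rewrite -[u](subrK v); apply: spannedD (spanned_ideal uv) vS. Qed.

Lemma spanned_brkr u v : (forall b, basis b -> spanned (brk u b)) ->
  spanned v -> spanned (brk u v).
Proof.
move=> uB [s [c [sB Iv]]]; apply: (@spanned_eqm _ (brk u (\sum_(b <- s) c b *: b))).
  by rewrite /eqm -brkNr -brkDr brkC; exact: (IN (IM _ Iv)).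
elim: s sB {Iv} => [|b s IHs] sB.
  by rewrite big_nil brk0r; apply: spanned_ideal.
rewrite big_cons brkDr brkZr; apply: spannedD.
  by apply/spannedZ/uB/sB/mem_head.
by apply: IHs => d ds; apply: sB; rewrite inE ds orbT.
Qed.

Lemma spanned_brkC u v : spanned (brk u v) -> spanned (brk v u).
Proof. by rewrite [brk v u]brkC; apply: spannedN. Qed.

Lemma spanned_word i g s : three g -> spanned (lnorm (xvar K i g) (ymap K s)).
Proof.
move=> g3; have [t tR /spanned_eqm] := word_reduction s g3 (LXG_var K i g); apply.
apply/spanned_basis/basisP.
by case: g3 => [[->|->]|->]; [exists (B1 i t) | exists (B2 i t) | exists (B3 i t)].
Qed.

Lemma comp_word2 i j s t :
  comp (eone + etwo) (lnorm (xvar K i eone) (ymap K s ++ xvar K j etwo :: ymap K t)).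
Proof.
rewrite lnorm_cat; apply: comp_lnorm; apply: LXG_brk; last exact: LXG_var.
exact/comp_lnorm/LXG_var.
Qed.

(** The two blocks of y's are reduced separately, with heads of degrees e_1 and e_1 e_2; no letter
    crosses x_{e_2}. *)
Lemma spanned_word2 i j s t :
  spanned (lnorm (xvar K i eone) (ymap K s ++ xvar K j etwo :: ymap K t)).
Proof.
have [||s' sR ss'] := @word_reduction eone (xvar K i eone) s; [by left; left|exact: LXG_var|].
have [||t' tR tt'] := @word_reduction (eone + etwo)
  (lnorm (xvar K i eone) (ymap K s' ++ [:: xvar K j etwo])) t; first by right.
  exact: (comp_word2 _ _ _ [::]).
apply: (@spanned_eqm _ (lnorm (xvar K i eone) (ymap K s' ++ xvar K j etwo :: ymap K t))).
  by rewrite !lnorm_cat; apply: eqm_lnorm.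
rewrite -cat1s catA lnorm_cat; apply: (spanned_eqm tt').
apply/spanned_basis/basisP; exists (B12 i j s' t'); first by [].
by rewrite /bcode_elt !lnorm_cat.
Qed.

(* [u, [w, y]] = [u, w, y] - [u, y, w] moves the outer variables of the     *)
(* second factor to the right.                                               *)
Lemma spanned_brk_words i j s t :
  spanned (brk (lnorm (xvar K i eone) (ymap K s)) (lnorm (xvar K j etwo) (ymap K t))).
Proof.
(* A trailing word [r] is carried along because each application of Jacobi leaves a variable on the
   far right. *)
suff gen r : spanned (lnorm (brk (lnorm (xvar K i eone) (ymap K s))
    (lnorm (xvar K j etwo) (ymap K t))) (ymap K r)) by exact: (gen [::]).
elim/last_ind: t s r => [|t l IHt] s r.
  by have := spanned_word2 i j s r; rewrite lnorm_cat.
rewrite /ymap map_rcons -cats1 lnorm_cat [lnorm _ [:: _]]/= brk_brkr -lnormB.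
apply: spannedD; first exact: (IHt s (l :: r)).
apply: spannedN; have := IHt (rcons s l) r.
by rewrite /ymap map_rcons -cats1 lnorm_cat.
Qed.

Lemma comp_bcode c : comp (bcode_deg c) (bcode_elt K c).
Proof.
case: c => [l|i s|i s|i s|i j s t] /=; [exact: LXG_var| | | |exact: comp_word2];
  exact/comp_lnorm/LXG_var.
Qed.

(** Multiplication table: a bracket with a y lengthens a word or is identity (ii), degrees e_1 and
    e_2 meet in [spanned_brk_words], and all other products have degree outside the support. *)
Lemma spanned_brk_basis b d : basis b -> basis d -> spanned (brk b d).
Proof.
have outside c c' : ~~ (bcode_deg c + bcode_deg c' \in [:: 0; eone; etwo; eone + etwo]) ->
    spanned (brk (bcode_elt K c) (bcode_elt K c')).
  move=> ccS; apply: spanned_ideal.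
  by apply: (ideal_deg (LXG_brk (comp_bcode c) (comp_bcode c'))) => /SuppGammaP; apply/negP.
have with_y c l : spanned (brk (bcode_elt K c) (y l)).
  case: c => [k|i s|i s|i s|i j s t] /=; first exact: (spanned_ideal (ideal_yy _ _)).
  - have := @spanned_word i eone (rcons s l); rewrite /ymap map_rcons -cats1 lnorm_cat.
    by apply; left; left.
  - have := @spanned_word i etwo (rcons s l); rewrite /ymap map_rcons -cats1 lnorm_cat.
    by apply; left; right.
  - have := @spanned_word i (eone + etwo) (rcons s l); rewrite /ymap map_rcons -cats1 lnorm_cat.
    by apply; right.
  - have := spanned_word2 i j s (rcons t l).
    by rewrite /ymap map_rcons -cats1 -cat_cons catA lnorm_cat.
move=> /basisP[c _ ->] /basisP[c' _ ->].
case: c c' => [l|i s|i s|i s|i j s t] [l'|i' s'|i' s'|i' s'|i' j' s' t'];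
  do ?[exact: with_y | exact/spanned_brkC/with_y | exact: spanned_brk_words
      | exact/spanned_brkC/spanned_brk_words | exact: outside].
Qed.

Lemma spanned_brk u v : spanned u -> spanned v -> spanned (brk u v).
Proof.
move=> uS; apply: spanned_brkr => b bB; apply: spanned_brkC; move: uS.
by apply: spanned_brkr => d dB; apply: spanned_brk_basis.
Qed.

Lemma spanned_var i g : spanned (xvar K i g).
Proof.
have [gS|gS] := pselect (SuppGamma g); last exact: (spanned_ideal (ideal_deg (LXG_var K i g) gS)).
have [->|g0] := eqVneq g 0; first by apply: spanned_basis; left; left; exists i.
apply: (@spanned_word i g [::]); move: g0; case: gS => [[[->|->]|->]|->] => // _.
- by left; left.
- by left; right.
- by right.
Qed.

Lemma spanned_all u : spanned u.
Proof.
elim/fl_ind: u; elim=> [[i g]||t IHt u IHu|a t IHt|t IHt u IHu].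
- exact: spanned_var.
- exact: (spanned_ideal I0).
- by rewrite -fl_addE; apply: spannedD.
- by rewrite -fl_scaleE; apply: spannedZ.
- by rewrite -fl_brkE; apply: spanned_brk.
Qed.

End Spanning.

(** * Action of diagonal matrices; the identities hold in UT_3 *)

Section UpperTriangular.
Variable K : fieldType.
Implicit Types (X A : UT3 K).

Lemma ut3_mxD X A i j : (X + A) i j = X i j + A i j.
Proof. by rewrite -[ut3_mx (X + A)]/(ut3_mx X + ut3_mx A) mxE. Qed.

Lemma ut3_mxZ a X i j : (a *: X) i j = a * X i j.
Proof. by rewrite -[ut3_mx (a *: X)]/(a *: ut3_mx X) mxE. Qed.

Lemma ut3_mx0 i j : (0 : UT3 K) i j = 0.
Proof. by rewrite -[ut3_mx 0]/(0 : 'M[K]_3) mxE. Qed.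

Lemma ut3P X A : (forall i j, X i j = A i j) -> X = A.
Proof. by move=> XA; apply/val_inj/matrixP. Qed.

Lemma Gamma0 g : Gamma K g 0.
Proof. by move=> i j; rewrite ut3_mx0 eqxx. Qed.

Lemma GammaD g X A : Gamma K g X -> Gamma K g A -> Gamma K g (X + A).
Proof.
move=> gX gA i j; rewrite ut3_mxD; have [->|/gX//] := eqVneq (X i j) 0.
by rewrite add0r => /gA.
Qed.

Lemma GammaZ g a X : Gamma K g X -> Gamma K g (a *: X).
Proof. by move=> gX i j; rewrite ut3_mxZ mulf_eq0 negb_or => /andP[_ /gX]. Qed.

Lemma Gamma_entry g X i j : Gamma K g X -> unit_deg i j != g -> X i j = 0.
Proof. by move=> gX; apply: contraNeq => /gX ->. Qed.

Lemma Gamma_diag A i j : Gamma K 0 A -> i != j -> A i j = 0.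
Proof.
move=> dA ij; case: (ltngtP i j) => [lt_ij|lt_ji|/val_inj eq_ij].
- apply: (Gamma_entry dA); case: i j lt_ij {ij} => [[|[|[|?]]] ?] [[|[|[|?]]] ?] //.
- by apply: (upper_triP _ (ut3_mxP A)).
- by rewrite eq_ij eqxx in ij.
Qed.

(** Matrix units are eigenvectors of a diagonal matrix, with eigenvalues the differences of its
    diagonal entries. Words in the y's thus evaluate to products of scalars. *)
Lemma brk_diag X A i j : Gamma K 0 A -> brk X A i j = X i j * (A j j - A i i).
Proof.
move=> dA; rewrite -[ut3_mx (brk X A)]/(X *m A - A *m X) !mxE.
rewrite (bigD1 j) //= [X in _ + X - _]big1 => [|k kj]; last first.
  by rewrite (Gamma_diag dA) ?mulr0.
rewrite (bigD1 i) //= [X in _ - (_ + X)]big1 => [|k ki]; last first.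
  by rewrite (Gamma_diag dA) ?mul0r // eq_sym.
by rewrite !addr0 mulrBr [A i i * _]mulrC.
Qed.

Lemma lnorm_diag X (T : eqType) (s : seq T) (A : T -> UT3 K) i j :
  (forall l, Gamma K 0 (A l)) ->
  lnorm X [seq A l | l <- s] i j = X i j * \prod_(l <- s) (A l j j - A l i i).
Proof.
move=> dA; elim: s X => [|l s IHs] X; first by rewrite big_nil mulr1.
by apply: etrans (IHs _) _; rewrite brk_diag // big_cons mulrA.
Qed.

Lemma graded_hom_UT3 (f : nat * G -> UT3 K) : (forall i g, Gamma K g (f (i, g))) ->
  @graded_hom K (LXG K) (UT3 K) (@LXG_comp K) (Gamma K) (fl_lift f).
Proof.
by apply: graded_hom_lift; [exact: Gamma0|exact: GammaD|exact: GammaZ|exact: Gamma_brk].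
Qed.

Lemma IdG_UT3_ideal : TG_ideal (IdG_UT3 K).
Proof.
split; first split.
- by move=> phi _; rewrite linear0.
- by move=> u v uI vI phi gphi; rewrite linearD uI ?vI ?addr0.
- by move=> a u uI phi gphi; rewrite linearZ /= uI ?scaler0.
- by move=> u v uI phi gphi; rewrite (proj1 gphi) uI ?brk0l.
move=> f [fB fg] u uI phi [phiB phig]; apply: (uI (phi \o f)%FUN).
split=> [v w|g v] /=; first by rewrite fB phiB.
by move=> /fg /phig.
Qed.

(** Components outside the support are zero, diagonal matrices commute, and the eigenvalues of a
    diagonal action satisfy t^q = t over a field with q elements. *)
Lemma identities_IdG : identities K `<=` IdG_UT3 K.
Proof.
move=> u [[[g gS <-]|->]|[q [Kq [g g3 ->]]]] phi gphi.
- apply: contrapT => /eqP nz; apply: gS; rewrite (SuppGammaE K) /=.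
  by exists (phi (xvar K 0 g)) => //; apply: (proj2 gphi); apply: LXG_var.
- rewrite (proj1 gphi); apply: ut3P => i j.
  have dY l : Gamma K 0 (phi (yvar K l)) by apply: (proj2 gphi); apply: LXG_var.
  rewrite brk_diag // ut3_mx0; have [->|ij] := eqVneq i j; first by rewrite subrr mulr0.
  by rewrite (Gamma_diag (dY 0)) ?mul0r.
- have dY : Gamma K 0 (phi (yvar K 0)) by apply: (proj2 gphi); apply: LXG_var.
  rewrite linearB /= (proj1 gphi) (graded_hom_lnorm _ _ gphi) map_nseq.
  apply/eqP; rewrite subr_eq0; apply/eqP/ut3P => i j; rewrite brk_diag //.
  have -> : nseq q (phi (yvar K 0)) = [seq phi (yvar K 0) | _ <- nseq q tt].
    by rewrite map_nseq.
  by rewrite lnorm_diag // big_const_seq count_predT size_nseq iter_mulr_1 (card_expf _ Kq).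
Qed.

End UpperTriangular.

(** * Evaluation at a generic point and independence modulo Id_G *)

Section Independence.
Variable K : fieldType.
Implicit Types (x : nat * nat -> K) (s t : seq nat) (c : bcode).

(* The value of the variables at a generic point: the coordinates of kinds   *)
(* 0, 1 are the diagonal entries t_l, s_l of y_l = diag(0, t_l, s_l), and    *)
(* those of kinds 2, 3, 4 are the entries at e_12, e_23, e_13.               *)
Definition generic_coef x (l : nat) (i j : 'I_3) : K :=
  match val i, val j with
  | 1%N, 1%N => x (0%N, l)
  | 2%N, 2%N => x (1%N, l)
  | 0%N, 1%N => x (2%N, l)
  | 1%N, 2%N => x (3%N, l)
  | 0%N, 2%N => x (4%N, l)
  | _, _ => 0
  end.

Lemma generic_subproof x (z : nat * G) :
  (\matrix_(i, j) (if unit_deg i j == z.2 then generic_coef x z.1 i j else 0))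
    \in @upper_tri K.
Proof.
apply/upper_triP => i j ji; rewrite mxE; case: ifP => // _.
by case: i j ji => [[|[|[|?]]] ?] [[|[|[|?]]] ?].
Qed.

Definition generic x (z : nat * G) : UT3 K := MkUT3 (generic_subproof x z).

Lemma genericE x l g i j :
  generic x (l, g) i j = if unit_deg i j == g then generic_coef x l i j else 0.
Proof. by rewrite /= mxE. Qed.

Lemma generic_Gamma x l g : Gamma K g (generic x (l, g)).
Proof. by move=> i j; rewrite genericE; case: (unit_deg i j =P g) => //; rewrite eqxx. Qed.

Local Notation o1 := (Ordinal (isT : 1 < 3)%N).
Local Notation o2 := (Ordinal (isT : 2 < 3)%N).

(** One coordinate for each degree of the support. In degree 1 the middle diagonal entry t_l is
    enough, the basis elements there being single variables. *)
Definition entry (g : G) (X : UT3 K) : K :=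
  if g == 0 then X o1 o1 else if g == eone then X ord0 o1
  else if g == etwo then X o1 o2 else X ord0 o2.

Lemma entry_eone X : entry eone X = X ord0 o1. Proof. by []. Qed.
Lemma entry_etwo X : entry etwo X = X o1 o2. Proof. by []. Qed.
Lemma entry_eone_etwo X : entry (eone + etwo) X = X ord0 o2. Proof. by []. Qed.

Lemma entry_Gamma g h X : h \in [:: 0; eone; etwo; eone + etwo] ->
  Gamma K g X -> g != h -> entry h X = 0.
Proof.
move=> hS gX; rewrite eq_sym => gh; move: hS gh.
by rewrite !inE => /or4P[] /eqP -> gh; apply: (Gamma_entry gX).
Qed.

Lemma brk_eone_etwo (X Z : UT3 K) : Gamma K eone X -> Gamma K etwo Z ->
  brk X Z ord0 o2 = X ord0 o1 * Z o1 o2.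
Proof.
move=> gX gZ; rewrite -[ut3_mx (brk X Z)]/(X *m Z - Z *m X) !mxE.
rewrite [X in _ - X]big1 ?subr0 => [|k _]; last first.
  rewrite (Gamma_entry gZ) ?mul0r //.
  by case: k => [[|[|[|?]]] ?].
rewrite (bigD1 o1) //= big1 ?addr0 // => k k1.
rewrite (Gamma_entry gX) ?mul0r //.
by case: k k1 => [[|[|[|?]]] ?].
Qed.

(* On the component of degree e_2 the words evaluate to products of the      *)
(* differences s_l - t_l; they become monomials when the t_l vanish.         *)
Definition mask (g : G) x : nat * nat -> K :=
  fun v => if (g == etwo) && (v.1 == 0%N) then 0 else x v.

(** The monomial to which the code evaluates. In [B12] the letters before x_{e_2} act on e_12 by t_l
    and those after it act on e_13 by s_l, so the two blocks remain distinguishable. *)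
Definition bcode_word c : seq (nat * nat) :=
  match c with
  | BY l => [:: (0, l)]
  | B1 i s => (2, i) :: [seq (0, l) | l <- s]
  | B2 i s => (3, i) :: [seq (1, l) | l <- s]
  | B3 i s => (4, i) :: [seq (1, l) | l <- s]
  | B12 i j s t => (2, i) :: (3, j) :: [seq (0, l) | l <- s] ++ [seq (1, l) | l <- t]
  end%N.

Definition generic_eval x : {linear LXG K -> UT3 K} := fl_lift (generic x).

Lemma generic_eval_graded x : graded_hom (@LXG_comp K) (Gamma K) (generic_eval x).
Proof. exact/graded_hom_UT3/generic_Gamma. Qed.

Lemma generic_eval_lnorm x u s i j :
  generic_eval x (lnorm u (ymap K s)) i j = generic_eval x u i j *
    \prod_(l <- s) (generic_coef x l j j - generic_coef x l i i).
Proof.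
rewrite (graded_hom_lnorm _ _ (generic_eval_graded x)) /ymap -map_comp.
rewrite lnorm_diag => [|l]; last by rewrite /= fl_lift_var; apply: generic_Gamma.
congr (_ * _); apply: eq_bigr => l _; rewrite /= fl_lift_var !genericE.
by case: i j => [[|[|[|?]]] ?] [[|[|[|?]]] ?].
Qed.

Lemma generic_eval_var x l g : generic_eval x (xvar K l g) = generic x (l, g).
Proof. by rewrite /= fl_lift_var. Qed.

(** The generic y_l acts on e_12, e_23, e_13 by t_l, s_l - t_l, s_l; the mask reduces the second
    weight to s_l. *)
Lemma generic_eval_bcode x c :
  entry (bcode_deg c) (generic_eval (mask (bcode_deg c) x) (bcode_elt K c)) =
  \prod_(v <- bcode_word c) x v.
Proof.
case: c => [l|i s|i s|i s|i j s t]; rewrite [bcode_deg _]/= [bcode_elt _ _]/=.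
- by rewrite generic_eval_var big_seq1 /entry eqxx genericE.
- rewrite entry_eone generic_eval_lnorm generic_eval_var genericE big_cons big_map.
  by congr (_ * _); apply: eq_bigr => l _; rewrite /generic_coef /= subr0.
- rewrite entry_etwo generic_eval_lnorm generic_eval_var genericE big_cons big_map.
  by congr (_ * _); apply: eq_bigr => l _; rewrite /generic_coef /= subr0.
- rewrite entry_eone_etwo generic_eval_lnorm generic_eval_var genericE big_cons big_map.
  by congr (_ * _); apply: eq_bigr => l _; rewrite /generic_coef /= subr0.
have -> : lnorm (xvar K i eone) (ymap K s ++ xvar K j etwo :: ymap K t) =
    lnorm (brk (lnorm (xvar K i eone) (ymap K s)) (xvar K j etwo)) (ymap K t).
  by rewrite lnorm_cat.
rewrite entry_eone_etwo generic_eval_lnorm (proj1 (generic_eval_graded _)).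
have [_ gr] := generic_eval_graded (mask (eone + etwo) x).
rewrite brk_eone_etwo; [|exact/gr/comp_lnorm/LXG_var|exact/gr/LXG_var].
rewrite generic_eval_lnorm !generic_eval_var !genericE.
rewrite !big_cons big_cat !big_map /= !mulrA [x (2%N, i) * _ * _]mulrAC.
by congr (_ * _ * _ * _); apply: eq_bigr => l _; rewrite /generic_coef /= subr0.
Qed.

Definition indices (k : nat) (w : seq (nat * nat)) : seq nat :=
  [seq v.2 | v <- w & v.1 == k].

Lemma indices_map k k' s :
  indices k [seq (k', l) | l <- s] = if k' == k then s else [::].
Proof.
rewrite /indices filter_map -map_comp; case: ifP => kk'.
  by rewrite (eq_filter (a2 := xpredT)) ?filter_predT ?map_id // => l /=; rewrite kk'.
by rewrite (eq_filter (a2 := pred0)) ?filter_pred0 // => l /=; rewrite kk'.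
Qed.

Lemma indices_cat k w w' : indices k (w ++ w') = indices k w ++ indices k w'.
Proof. by rewrite /indices filter_cat map_cat. Qed.

Lemma indices_cons k v w :
  indices k (v :: w) = if v.1 == k then v.2 :: indices k w else indices k w.
Proof. by rewrite /indices /=; case: ifP. Qed.

Lemma perm_indices k w w' : perm_eq w w' -> perm_eq (indices k w) (indices k w').
Proof. by move=> ww'; apply/perm_map/perm_filter. Qed.

Lemma count_indices v w : count_mem v w = count_mem v.2 (indices v.1 w).
Proof.
rewrite count_map count_filter; apply: eq_count => v' /=.
by rewrite [RHS]andbC -[v' == v]/((_ == _) && (_ == _)).
Qed.

Let indicesE := (indices_cons, indices_cat, indices_map, cats0).

Lemma lt_card_bcode_word c v : bcode_wf K c -> lt_card K (count_mem v (bcode_word c)).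
Proof.
have K1 : lt_card K 1 := @lt_card1 K.
have K0 : lt_card K 0 := lt_cardW (leq0n 1) K1.
have Kn b : lt_card K (b : bool) by case: b.
have Kr s l : reduced K s -> lt_card K (count_mem l s) by case.
rewrite count_indices; case: v => k l.
case: c => [l'|i s|i s|i s|i j s t] /=;
  do ?case=> ? ?; case: k => [|[|[|[|[|k]]]]]; rewrite !indicesE //= ?addn0 //.
  exact: Kr.
exact: Kr.
Qed.

(** The kinds of coordinates split the monomial into the blocks of the code, and a sorted block is
    determined by its multiset of letters. *)
Lemma bcode_word_inj c c' : bcode_wf K c -> bcode_wf K c' ->
  bcode_deg c = bcode_deg c' -> perm_eq (bcode_word c) (bcode_word c') -> c = c'.
Proof.
have sorted_inj s t : reduced K s -> reduced K t -> perm_eq s t -> s = t.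
  by move=> [sS _] [tS _]; apply: (sorted_eq leq_trans anti_leq).
have single_inj (k l : nat) : perm_eq [:: k] [:: l] -> k = l.
  by move=> /perm_mem/(_ k); rewrite !inE eqxx => /esym/eqP.
move=> + + + ww'; have idx k := perm_indices k ww'.
move: (idx 0%N) (idx 1%N) (idx 2%N) (idx 3%N) (idx 4%N) => {idx ww'}.
case: c c' => [l|i s|i s|i s|i j s t] [l'|i' s'|i' s'|i' s'|i' j' s' t'] //;
  rewrite /= !indicesE /=.
(* The different shapes of equal degree, [B3] and [B12], are told apart by kind 4. *)
all: try by move=> _ _ _ _ /perm_size.
- by move=> /single_inj ->.
- by move=> ss' _ /single_inj -> _ _ sR sR' _; rewrite (sorted_inj s s').
- by move=> _ ss' _ /single_inj -> _ sR sR' _; rewrite (sorted_inj s s').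
- by move=> _ ss' _ _ /single_inj -> sR sR' _; rewrite (sorted_inj s s').
move=> ss' tt' /single_inj -> /single_inj -> _ [sR tR] [sR' tR'] _.
by rewrite (sorted_inj s s') // (sorted_inj t t').
Qed.

Lemma entry_sum (I : Type) (r : seq I) (F : I -> UT3 K) g :
  entry g (\sum_(i <- r) F i) = \sum_(i <- r) entry g (F i).
Proof.
have mx_sum i j : (\sum_(k <- r) F k) i j = \sum_(k <- r) F k i j.
  elim/big_rec2: _ => [|k a X _ <-]; [exact: ut3_mx0 | exact: ut3_mxD].
by rewrite /entry; do ?case: ifP => _; apply: mx_sum.
Qed.

Lemma entryZ g a X : entry g (a *: X) = a * entry g X.
Proof. by rewrite /entry; do ?case: ifP => _; apply: ut3_mxZ. Qed.

(** Reading the entry of the degree of [b] at the masked generic point kills the terms of other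
    degrees and leaves a vanishing combination of distinct monomials. *)
Lemma basis_free (s : seq (LXG K)) (c : LXG K -> K) :
  uniq s -> (forall b, b \in s -> basis b) ->
  IdG_UT3 K (\sum_(b <- s) c b *: b) -> forall b, b \in s -> c b = 0.
Proof.
move=> sU sB sI b bs.
have code_ex d : exists e, basis d -> bcode_wf K e /\ d = bcode_elt K e.
  have [/basisP[e ewf ->]|dB] := pselect (basis d); first by exists e.
  by exists (BY 0).
have [code codeP] := choice code_ex.
pose g := bcode_deg (code b).
have gS : g \in [:: 0; eone; etwo; eone + etwo].
  by rewrite /g; case: (code b) => *; rewrite !inE eqxx ?orbT.
apply: (@words_free K _ _ [seq d <- s | bcode_deg (code d) == g] (bcode_word \o code)).
- exact: filter_uniq.
- move=> d v; rewrite mem_filter => /andP[_ /sB/codeP[wf _]].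
  exact: lt_card_bcode_word.
- move=> d e; rewrite !mem_filter => /andP[/eqP dg /sB/codeP[dwf dE]].
  move=> /andP[/eqP eg /sB/codeP[ewf eE]] de; rewrite dE eE.
  by congr bcode_elt; apply: bcode_word_inj => //; rewrite dg eg.
- move=> x; have := congr1 (entry g) (sI _ (generic_eval_graded (mask g x))).
  rewrite linear_sum entry_sum big_filter => sum0.
  have entry0 : entry g (0 : UT3 K) = 0 by rewrite /entry; do ?case: ifP => _; rewrite ut3_mx0.
  rewrite -[RHS]entry0 -sum0 big_mkcond big_seq [RHS]big_seq; apply: eq_bigr => d /sB/codeP[dwf dE].
  rewrite linearZ entryZ; case: ifP => [/eqP dg|/negbT dg].
    by congr (_ * _); rewrite [in RHS]dE -dg generic_eval_bcode.
  rewrite (entry_Gamma gS _ dg) ?mulr0 // [X in generic_eval _ X]dE.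
  exact/(proj2 (generic_eval_graded _))/comp_bcode.
by rewrite mem_filter eqxx.
Qed.

End Independence.

(** * Equality of the two ideals and the basis *)

Theorem theorem3p1 (K : fieldType) :
  IdG_UT3 K = TG_generated (identities K) /\
  basis_modulo (IdG_UT3 K) (basis0 K `|` basis1 K `|` basis2 K).
Proof.
have sub : TG_generated (identities K) `<=` IdG_UT3 K.
  by apply: smallest_sub; [exact: IdG_UT3_ideal | exact: identities_IdG].
split; last split; last exact: basis_free.
(* The combination representing [f] modulo the generated ideal lies in Id_G, hence is zero by
   independence once repetitions in [s] are collapsed. *)
- apply/seteqP; split => // f fI; have [s [c [sB fs]]] := spanned_all f.
  suff s0 : \sum_(b <- s) c b *: b = 0 by move: fs; rewrite s0 subr0.
  have sE := @sum_count_mem _ _ s (undup s) c (undup_uniq s) _.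
  rewrite -sE => [|b]; last by rewrite mem_undup.
  have c0 := @basis_free K (undup s) (fun b => c b *+ count_mem b s) (undup_uniq s).
  rewrite big_seq big1 // => b bs; rewrite c0 ?scale0r // => [d|].
    by rewrite mem_undup => /sB.
  rewrite sE => [|d]; last by rewrite mem_undup.
  have := lie_idealB (proj1 (IdG_UT3_ideal K)) fI (sub _ fs).
  by rewrite opprB addrC subrK.
- by move=> f; have [s [c [sB fs]]] := spanned_all f; exists s, c; split=> //; apply: sub.
Qed.
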